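(* Let $m,n\ge 1$ and let $R=(r_1,\dots,r_m)$ and $S=(s_1,\dots,s_n)$ be vectors of nonnegative integers with $r_i\le n$ for all $i$, $s_j\le m$ for all $j$, and $\sum_i r_i=\sum_j s_j$. Then $\mathcal{A}^{\infty}(R,S)\neq\emptyset$ if and only if all of the following hold: (a) $S$ is palindromic, i.e. $s_j=s_{n+1-j}$ for all $j$; (b) if $n$ is even then every component of $R$ is even, and if $n$ is odd then $s_{\lceil n/2\rceil}\ge o(R)$, where $o(R)$ is the number of odd components of $R$; (c) $\overline{S}\preceq \overline{R}^*$, where $\overline{R}$ is obtained from $R$ by subtracting one from every odd component, and $\overline{S}$ is $S$ if $n$ is even, or $S$ with the component $s_{\lceil n/2\rceil}$ removed if $n$ is odd.
   Context: $\mathcal{A}^{\infty}(R,S)$ is the set of $m\times n$ matrices $A$ with entries in $\{0,1\}$, with $i$th row sum $r_i$ and $j$th column sum $s_j$ for all $i,j$, that are invariant under the reflection $r_\infty$ in a vertical line, i.e. $a_{i,j}=a_{i,\,n+1-j}$ for all $i,j$. For a nonnegative integer vector $R$, $R^*$ denotes the conjugate of (the weakly decreasing rearrangement of) $R$ viewed as an integer partition: its $k$th component is the number of $i$ with $r_i\ge k$. For nonnegative integer vectors $U,V$, $V\preceq U$ ($V$ is majorized by $U$) means that, after rearranging both in weakly decreasing order (and padding with zeros to a common length), $u_1+\dots+u_\ell\ge v_1+\dots+v_\ell$ for all $\ell$, and the total sums of $U$ and $V$ are equal. *)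

(* Defs.v *)
From mathcomp Require Import all_boot all_algebra.

Set Implicit Arguments.
Unset Strict Implicit.
Unset Printing Implicit Defensive.

(* Entries in {0,1} are encoded as booleans, counted through the coercion
   bool >-> nat. Indices start at 0, so that the reflection j |-> n + 1 - j of
   {1, ..., n} is rev_ord. *)
Definition reflection_class (m n : nat) (R : m.-tuple nat) (S : n.-tuple nat) :
    {set 'M[bool]_(m, n)} :=
  [set A : 'M[bool]_(m, n) |
    [&& [forall i, \sum_(j < n) A i j == tnth R i],
        [forall j, \sum_(i < m) A i j == tnth S j]
      & [forall i, [forall j, A i j == A i (rev_ord j)]]]].

(* Components number 1, ..., max R; the later ones are all 0. *)
Definition conjugate (R : seq nat) : seq nat :=
  [seq count (leq k) R | k <- iota 1 (\max_(r <- R) r)].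

(* Padding with zeros is implicit: take l s is s as soon as l >= size s. *)
Definition majorized (V U : seq nat) : Prop :=
  (forall l, sumn (take l (sort geq V)) <= sumn (take l (sort geq U))) /\
  sumn V = sumn U.

Definition palindromic (n : nat) (S : n.-tuple nat) : Prop :=
  forall j : 'I_n, tnth S j = tnth S (rev_ord j).

Definition num_odd (R : seq nat) : nat := count odd R.

Definition round_even (R : seq nat) : seq nat := [seq r - odd r | r <- R].

(* For odd size, the 1-based middle index uphalf (size S) is the 0-based index
   (size S)./2. *)
Definition middle (S : seq nat) : nat := nth 0 S (size S)./2.

Definition drop_middle (S : seq nat) : seq nat :=
  if odd (size S) then take (size S)./2 S ++ drop (size S)./2.+1 S else S.

(* Main.v *)
(* A palindromic matrix is determined by its left half and, for odd n, its
   middle column, which must be the parity vector of R. So it exists iff the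
   half matrix, with row sums r_i/2 (rounded down) and column sums
   s_1, ..., s_(n/2), does, and this is decided by the Gale-Ryser theorem. The
   inequality s_mid >= o(R) is in fact an equality, because majorization fixes
   the sum of the other columns.
   For sufficiency in Gale-Ryser, start from any matrix with the right row
   sums and move ones between columns: column j can give a one to column k when
   some row has a 1 in j and a 0 in k. If no column with a deficit is reachable
   from a column with an excess, the set of unreachable columns violates the
   domination hypothesis. *)
Require Import Defs.
From mathcomp Require Import all_boot all_algebra zify.

Set Implicit Arguments.
Unset Strict Implicit.
Unset Printing Implicit Defensive.

(** * Column transfers and the Gale-Ryser theorem *)

Lemma sum_ltn_minn n r : \sum_(j < n) (j < r) = minn r n.
Proof.
elim: n => [|n IHn]; first by rewrite big_ord0 minn0.
by rewrite big_ord_recr /= IHn; lia.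
Qed.

Lemma sum_andb_pred1 (J : finType) (b : bool) (j : J) :
  \sum_k (b && (k == j)) = b.
Proof.
rewrite (bigD1 j) //= eqxx andbT big1 ?addn0 // => k /negPf ->.
by rewrite andbF.
Qed.

Definition exceeds (I J : finType) (A : I -> J -> bool) : rel J :=
  fun j k => [exists i, A i j && ~~ A i k].

(** Each intermediate column of the path gains a one and gives one away, so only the two ends
    change. The term [k == j] on the left avoids a truncated subtraction. *)
Lemma transfer_path (I J : finType) (A : I -> J -> bool) (j : J) (p : seq J) :
  path (exceeds A) j p -> uniq (j :: p) ->
  exists A' : I -> J -> bool,
    (forall i, \sum_k A' i k = \sum_k A i k) /\
    (forall k, \sum_i A' i k + (k == j) = \sum_i A i k + (k == last j p)).
Proof.
elim: p A j => [|z p IHp] A j /=; first by exists A.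
case/andP=> /existsP[i /andP[Aij Aiz]] ezp.
rewrite inE negb_or => /andP[/andP[neq_jz j_p] /andP[z_p uniq_p]].
(* [A1] moves the one of row [i] from column [j] to column [z]. *)
pose A1 i' k := if i' == i then (k != j) && ((k == z) || A i' k) else A i' k.
have A1E i' k :
    A1 i' k + ((i' == i) && (k == j)) = A i' k + ((i' == i) && (k == z)).
  rewrite /A1; have [->|] := eqVneq i' i => //=.
  have [->|_] := eqVneq k j; first by rewrite Aij (negPf neq_jz).
  by have [->|_] := eqVneq k z; rewrite ?(negPf Aiz) /= ?addn0.
(* The transfer enlarges column z and shrinks only column j, which the rest of
   the path avoids, so that rest remains a path. *)
have e1zp : path (exceeds A1) z p.
  have rest q x : j != x -> j \notin q -> z \notin q ->
      path (exceeds A) x q -> path (exceeds A1) x q.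
    elim: q x => //= y q IHq x jx; rewrite !inE !negb_or.
    move=> /andP[jy j_q] /andP[zy z_q] /andP[exy eyq].
    rewrite IHq // andbT; case/existsP: exy => i' /andP[Aix Aiy].
    apply/existsP; exists i'; rewrite /A1; case: eqP => _; last by rewrite Aix.
    by rewrite Aix orbT andbT eq_sym jx eq_sym jy eq_sym (negPf zy).
  exact: rest.
have [|A' [rowA' colA']] := IHp A1 z e1zp; first by rewrite /= z_p.
exists A'; split=> [i'|k].
  rewrite rowA'; apply/eqP; rewrite -(eqn_add2r (i' == i)).
  rewrite -{1}(sum_andb_pred1 (i' == i) j) -(sum_andb_pred1 (i' == i) z).
  by rewrite -!big_split; apply/eqP/eq_bigr.
have col1 : \sum_i A1 i k + (k == j) = \sum_i A i k + (k == z).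
  rewrite -(sum_andb_pred1 (k == j) i) -(sum_andb_pred1 (k == z) i).
  by rewrite -!big_split; apply: eq_bigr => i' _; rewrite ![(k == _) && _]andbC.
by have := colA' k; lia.
Qed.

(** Row [i] can place at most [minn (r i) #|K|] ones in the columns of [K]. Ranging over all sets
    [K] avoids sorting [c]. *)
Lemma gale_ryser (I : finType) (n : nat) (r : I -> nat) (c : 'I_n -> nat) :
  (forall i, r i <= n) -> \sum_i r i = \sum_j c j ->
  (forall K : {set 'I_n}, \sum_(j in K) c j <= \sum_i minn (r i) #|K|) ->
  exists A : I -> 'I_n -> bool,
    (forall i, \sum_j A i j = r i) /\ (forall j, \sum_i A i j = c j).
Proof.
move=> r_le eq_rc dom.
(* Induction on e, a bound on the total excess of the column sums over c. *)
suff improve e (A : I -> 'I_n -> bool) : (forall i, \sum_j A i j = r i) ->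
    \sum_j (\sum_i A i j - c j) <= e ->
    exists A' : I -> 'I_n -> bool,
      (forall i, \sum_j A' i j = r i) /\ (forall j, \sum_i A' i j = c j).
  (* The starting matrix has all rows left-justified. *)
  apply: (improve _ (fun i (j : 'I_n) => j < r i)) (leqnn _) => i.
  by rewrite sum_ltn_minn; apply/minn_idPl.
elim: e A => [|e IHe] A rowA excess.
  (* No column sum exceeds its target and the totals agree, so equality holds in every column. *)
  exists A; split=> // j; have eq_dc: \sum_j \sum_i A i j = \sum_j c j.
    by rewrite exchange_big -eq_rc; apply: eq_bigr.
  move: excess; rewrite leqn0 sum_nat_eq0 => /forallP le_dc.
  have {}le_dc k : \sum_i A i k <= c k by rewrite -subn_eq0 (implyP (le_dc k)).
  have: \sum_j (c j - \sum_i A i j) == 0.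
    by rewrite sumnB ?eq_dc ?subnn // => k _.
  rewrite sum_nat_eq0 => /forallP/(_ j); rewrite /= subn_eq0 => le_cd.
  by apply/eqP; rewrite eqn_leq le_dc.
have eq_dc: \sum_j \sum_i A i j = \sum_j c j.
  by rewrite exchange_big -eq_rc; apply: eq_bigr.
case: (pickP [pred j | c j < \sum_i A i j]) => [j /= lt_cd | no_excess]; last first.
  apply: (IHe A) => //; rewrite big1 // => k _; apply/eqP.
  by rewrite subn_eq0 leqNgt; apply/negP => lt_cd; have := no_excess k; rewrite /= lt_cd.
case: (pickP [pred k | connect (exceeds A) j k && (\sum_i A i k < c k)]).
  move=> k /= /andP[/connectP[p0 /shortenP[p path_p uniq_p _] k_last] lt_dc].
  have [A' [rowA' colA']] := transfer_path path_p uniq_p.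
  apply: (IHe A') => [i|]; first by rewrite rowA'.
  have neq_jk : j != k by apply: contraTneq lt_cd => ->; lia.
  (* Column [j] loses one unit of excess, and column [k], having a deficit, gains a one without
     getting an excess. *)
  rewrite -ltnS; apply: leq_trans excess; rewrite (bigD1 j) // [ltnRHS](bigD1 j) //=.
  rewrite -addSn leq_add //.
    by have := colA' j; rewrite eqxx -k_last (negPf neq_jk); lia.
  apply: leq_sum => l neq_lj; have := colA' l; rewrite (negPf neq_lj) -k_last.
  by have [->|] := eqVneq l k; lia.
move=> no_deficit; pose K : {set 'I_n} := [set k | ~~ connect (exceeds A) j k].
(* A row with a one in a reachable column has ones throughout [K], since a zero there would make
   that column reachable. Any other row has all its ones in [K]. *)
have ge_min i : minn (r i) #|K| <= \sum_(k in K) A i k.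
  case: (pickP [pred x | connect (exceeds A) j x && A i x]) => [x /= | none].
    case/andP=> jx Aix; rewrite geq_min -sum1_card leq_sum ?orbT // => k.
    rewrite inE => jk; rewrite lt0b; apply: contraR jk => Aik.
    by apply: connect_trans jx (connect1 _); apply/existsP; exists i; rewrite Aix.
  rewrite geq_min -rowA (bigID (mem K)) /= [X in _ + X]big1 ?addn0 ?leqnn // => k.
  by rewrite inE negbK => jk; have := none k; rewrite /= jk /= => ->.
have leK : \sum_(k in K) c k <= \sum_(k in K) \sum_i A i k.
  by rewrite exchange_big; apply: leq_trans (dom K) (leq_sum _ _) => i _.
(* Outside [K] no column has a deficit and [j] has an excess; with [leK] this contradicts the
   equality of the totals. *)
suff: \sum_(k | k \notin K) c k < \sum_(k | k \notin K) \sum_i A i k.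
  move: eq_dc; rewrite (bigID (mem K)) [RHS](bigID (mem K)) /= => eq_dc lt_cd'.
  by have := leq_add leK lt_cd'; rewrite addnS eq_dc ltnn.
have jK : j \notin K by rewrite inE connect0.
rewrite (bigD1 j) // [ltnRHS](bigD1 j) //= -addSn leq_add //.
apply: leq_sum => k /andP[]; rewrite inE negbK => jk _.
by rewrite leqNgt; have := no_deficit k; rewrite /= jk /= => ->.
Qed.

(** * Sorted prefixes as sums over index sets, and conjugates *)

Lemma sumn_subseq_take (s t : seq nat) :
  sorted geq s -> subseq t s -> sumn t <= sumn (take (size t) s).
Proof.
elim: s t => [|x s IHs] [|y t] //= sorted_xs sub_yt.
have x_max : all (geq x) s.
  by apply: order_path_min sorted_xs => a b c; rewrite /=; lia.
rewrite leq_add ?IHs ?(path_sorted sorted_xs) //.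
  case: eqP sub_yt => [->//|_] /mem_subseq/(_ y); rewrite mem_head => /(_ isT).
  by move/(allP x_max).
by case: eqP sub_yt => // _; apply: subseq_trans (subseq_cons _ _).
Qed.

Lemma geq_total : total geq. Proof. by move=> x y; apply: leq_total. Qed.

Lemma geq_trans : transitive geq.
Proof. by move=> y x z xy yz; apply: leq_trans yz xy. Qed.

Lemma sum_le_take_sort (T : finType) (f : T -> nat) (s : seq T) (K : {set T}) :
  uniq s -> {subset K <= s} ->
  \sum_(x in K) f x <= sumn (take #|K| (sort geq (map f s))).
Proof.
move=> uniq_s sKs; pose t := [seq x <- s | x \in K].
have perm_t : perm_eq t (enum K).
  apply: uniq_perm (filter_uniq _ uniq_s) (enum_uniq _) _ => x.
  by rewrite mem_filter mem_enum; case: (boolP (x \in K)) => // /sKs ->.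
rewrite -big_enum -(perm_big _ perm_t) -(big_map f predT id) -sumnE.
rewrite cardE -(perm_size perm_t) -(size_map f t) -(size_sort geq).
have -> : sumn (map f t) = sumn (sort geq (map f t)).
  by apply/perm_sumn; rewrite perm_sym perm_sort.
apply: sumn_subseq_take; first exact/sort_sorted/geq_total.
apply: subseq_sort; [exact: geq_total | exact: geq_trans |].
exact/map_subseq/filter_subseq.
Qed.

(** The [l] largest values are attained on a set of indices; it has fewer than [l] elements when [l]
    exceeds [size s]. *)
Lemma sum_take_sort (T : finType) (f : T -> nat) (s : seq T) (l : nat) :
  uniq s ->
  exists K : {set T}, [/\ {subset K <= s}, #|K| <= l &
    sumn (take l (sort geq (map f s))) = \sum_(x in K) f x].
Proof.
move=> uniq_s; rewrite sort_map -map_take.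
set t := sort _ s; have uniq_t : uniq (take l t) by rewrite take_uniq ?sort_uniq.
exists [set x in take l t]; split=> [x||].
- by rewrite inE => /mem_take; rewrite mem_sort.
- by rewrite cardsE (card_uniqP uniq_t) size_take_min geq_minl.
- rewrite sumnE big_map big_uniq //=.
  by apply: eq_bigl => x; rewrite inE.
Qed.

(** Both sides count the cells in the first [l] columns of the Young diagram of [R]. *)
Lemma sumn_take_conjugate (l : nat) (R : seq nat) :
  sumn (take l (sort geq (conjugate R))) = \sum_(r <- R) minn r l.
Proof.
rewrite (sorted_sort geq_trans); last first.
  rewrite /conjugate; apply: homo_sorted (iota_sorted 1 _) => k k' le_kk'.
  by apply: sub_count => r /(leq_trans le_kk').
rewrite /conjugate -map_take take_iota sumnE big_map.
under eq_bigr do rewrite -sum1_count big_mkcond.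
rewrite exchange_big big_seq [RHS]big_seq /=; apply: eq_bigr => r rR.
have le_rM : r <= \max_(r <- R) r by rewrite leq_bigmax_seq.
(* The list [conjugate R] stops at the maximum of [R], so [l] is capped there; this is harmless
   because [r] is at most that maximum. *)
have -> : minn r l = minn r (minn l (\max_(r <- R) r)) by lia.
move: (minn _ (\max_(r <- R) r)) => p; elim: p => [|p IHp].
  by rewrite big_nil minn0.
rewrite -[p.+1]addn1 iotaD big_cat big_seq1 IHp /=.
by case: leqP; lia.
Qed.

Lemma sumn_conjugate (R : seq nat) : sumn (conjugate R) = sumn R.
Proof.
(* This prefix is long enough to cover the whole list and to make every [minn] equal to its [r]. *)
have -> : sumn (conjugate R) =
    sumn (take (maxn (size (conjugate R)) (\max_(r <- R) r)) (sort geq (conjugate R))).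
  rewrite take_oversize ?size_sort ?leq_maxl //.
  by apply/perm_sumn; rewrite perm_sym perm_sort.
rewrite sumn_take_conjugate sumnE big_seq [RHS]big_seq; apply: eq_bigr => r rR.
apply/minn_idPl; apply: leq_trans (leq_maxr _ _).
by rewrite leq_bigmax_seq.
Qed.

(** * Reflection of indices and the middle column *)

Definition off_middle (n : nat) : pred nat := fun j => ~~ (odd n && (j == n./2)).

(** Listing the surviving indices makes the lemmas on sums over index sets applicable to the
    shortened vector. *)
Lemma drop_middleE (n : nat) (S : n.-tuple nat) :
  drop_middle S = [seq tnth S j | j : 'I_n <- enum 'I_n & off_middle n j].
Proof.
have -> : [seq tnth S j | j : 'I_n <- enum 'I_n & off_middle n j] =
    [seq nth 0 S k | k <- iota 0 n & off_middle n k].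
  rewrite -val_enum_ord filter_map -map_comp.
  by apply: eq_map => j; rewrite /= (tnth_nth 0).
rewrite /drop_middle size_tuple /off_middle; case: ifP => odd_n /=; last first.
  by rewrite filter_predT -[in iota _ _](size_tuple S) map_nth_iota0 ?take_size.
have n_eq : n = n./2 + (1 + n./2) by have := odd_double_half n; lia.
rewrite [in iota 0 n]n_eq !iotaD !filter_cat /= eqxx /= map_cat; congr (_ ++ _).
  rewrite (_ : filter _ _ = iota 0 n./2).
    by rewrite (map_nth_iota0 0) // size_tuple; lia.
  by apply/all_filterP/allP => k; rewrite mem_iota; lia.
rewrite (_ : filter _ _ = iota n./2.+1 n./2); last first.
  by rewrite addn1; apply/all_filterP/allP => k; rewrite mem_iota; lia.
rewrite map_nth_iota ?size_tuple; last by lia.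
by rewrite take_oversize // size_drop size_tuple; lia.
Qed.

Lemma sum_off_middle (n : nat) (F : nat -> nat) :
  \sum_(j < n) F j = \sum_(j < n | off_middle n j) F j + odd n * F n./2.
Proof.
rewrite /off_middle; case: (boolP (odd n)) => odd_n /=; last by rewrite addn0.
have lt_hn : n./2 < n by have := odd_double_half n; lia.
by rewrite (bigD1 (Ordinal lt_hn)) //= addnC mul1n.
Qed.

Lemma sum_palindrome (n : nat) (F : nat -> nat) :
  (forall j, j < n -> F (n - j.+1) = F j) ->
  \sum_(j < n) F j = (\sum_(j < n./2) F j).*2 + odd n * F n./2.
Proof.
move=> palF; have n_eq := odd_double_half n.
rewrite -!(big_mkord xpredT F).
(* With cuts at [n./2] and [n - n./2], the outer blocks are mirror images and the inner one is empty
   or a single index. *)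
rewrite (@big_cat_nat _ _ _ n./2) ?leq_half //=; last by lia.
rewrite (@big_cat_nat _ _ _ (n - n./2) n./2) //=; [|by lia|by lia].
rewrite -addnn -addnA; congr (_ + _); rewrite addnC; congr (_ + _).
  rewrite -[n - n./2]add0n big_addn big_nat_rev !big_mkord subKn; last by lia.
  apply: eq_bigr => j _; have lt_jh : j < n./2 := ltn_ord j.
  rewrite -palF; last by lia.
  by congr F; lia.
case: (boolP (odd n)) n_eq => _ /= n_eq; last by rewrite big_geq //; lia.
by rewrite (_ : n - n./2 = n./2.+1) ?big_nat1 ?mul1n //; lia.
Qed.

(* Both halves of {0, ..., n - 1} are filled from f, and the middle index, which
   exists only for odd n, gets x0. *)
Definition mirror (T : Type) (n : nat) (f : 'I_n./2 -> T) (x0 : T) (k : nat) :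
    T :=
  if insub (minn k (n - k.+1)) is Some j then f j else x0.

Lemma mirror_rev (T : Type) (n : nat) (f : 'I_n./2 -> T) (x0 : T) (k : nat) :
  k < n -> mirror f x0 (n - k.+1) = mirror f x0 k.
Proof.
by move=> lt_kn; rewrite /mirror; congr (if insub _ is Some _ then _ else _); lia.
Qed.

Lemma mirror_ord (T : Type) (n : nat) (f : 'I_n./2 -> T) (x0 : T) (j : 'I_n./2) :
  mirror f x0 j = f j.
Proof.
have n_eq := odd_double_half n; have lt_j := ltn_ord j.
by rewrite /mirror (_ : minn j (n - j.+1) = j) ?valK //; lia.
Qed.

(** At the middle, [k] and [n - k.+1] both equal [n./2], which is out of range for ['I_n./2], so the
    default [x0] is taken. *)
Lemma mirror_middle (T : Type) (n : nat) (f : 'I_n./2 -> T) (x0 : T) :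
  odd n -> mirror f x0 n./2 = x0.
Proof.
move=> odd_n; have n_eq := odd_double_half n.
by rewrite /mirror insubF //; lia.
Qed.

(** A set of left-half columns and its mirror image together avoid the middle. This transports the
    domination condition between full and half width. *)
Lemma sum_mirror_set (n : nat) (K : {set 'I_n./2}) (F : nat -> nat) :
  (forall j, j < n -> F (n - j.+1) = F j) ->
  \sum_(j in [set j : 'I_n | mirror (fun k => k \in K) false j]) F j =
  (\sum_(k in K) F k).*2.
Proof.
move=> palF; rewrite big_mkcond [in RHS]big_mkcond /=.
pose G j := if mirror (fun k => k \in K) false j then F j else 0.
rewrite (eq_bigr (fun j : 'I_n => G j)); last by move=> j _; rewrite inE.
rewrite sum_palindrome => [|j lt_jn]; last by rewrite /G mirror_rev ?palF.
have -> : odd n * G n./2 = 0.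
  by case: (boolP (odd n)) => // odd_n; rewrite /G mirror_middle.
rewrite addn0; congr _.*2; apply: eq_bigr => j _.
by rewrite /G mirror_ord.
Qed.

(** * Passing between a palindromic matrix and its left half *)

Theorem theorem12 (m n : nat) (R : m.-tuple nat) (S : n.-tuple nat)
    (hm : 1 <= m) (hn : 1 <= n)
    (hR : forall i : 'I_m, tnth R i <= n)
    (hS : forall j : 'I_n, tnth S j <= m)
    (hRS : \sum_(i < m) tnth R i = \sum_(j < n) tnth S j) :
  reflection_class R S <> set0 <->
  [/\ palindromic S,
      (~~ odd n -> forall i : 'I_m, ~~ odd (tnth R i)) /\
      (odd n -> num_odd R <= middle S)
    & majorized (drop_middle S) (conjugate (round_even R))].
Proof.
have n_eq := odd_double_half n.
pose s := nth 0 S; have SE j : tnth S j = s j by rewrite (tnth_nth 0).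
have num_oddE : num_odd R = \sum_(i < m) odd (tnth R i).
  by rewrite /num_odd -sum1_count big_mkcond big_tuple.
have roundE (g : nat -> nat) :
    \sum_(r <- round_even R) g r = \sum_(i < m) g (tnth R i)./2.*2.
  rewrite big_map big_tuple; apply: eq_bigr => i _.
  by rewrite -{1}(odd_double_half (tnth R i)) addKn.
have middleE : middle S = s n./2 by rewrite /middle size_tuple.
pose I := [seq j : 'I_n <- enum 'I_n | off_middle n j].
have uniq_I : uniq I by rewrite filter_uniq ?enum_uniq.
have sum_drop : sumn (drop_middle S) = \sum_(j < n | off_middle n j) s j.
  rewrite drop_middleE sumnE big_map big_filter big_enum_cond.
  by apply: eq_bigr => j _.
have totalR : \sum_(i < m) tnth R i = sumn (round_even R) + num_odd R.
  rewrite sumnE roundE num_oddE -big_split; apply: eq_bigr => i _ /=.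
  by rewrite addnC odd_double_half.
have totalS : \sum_(j < n) tnth S j =
    \sum_(j < n | off_middle n j) s j + odd n * s n./2.
  by rewrite -sum_off_middle; apply: eq_bigr => j _.
split=> [/eqP/set0Pn[A]|[palS [even_case _] [dom sum_eq]]].
  rewrite inE => /and3P[/forallP rowA /forallP colA /forallP palA].
  have rowAE i : \sum_(j < n) A i j = tnth R i by apply/eqP/rowA.
  have colAE j : \sum_(i < m) A i j = tnth S j by apply/eqP/colA.
  (* Rows are extended by zero to all of [nat], as [sum_palindrome] requires. *)
  pose a i k : nat := if insub k is Some j then A i j else false.
  have aE i (j : 'I_n) : a i j = A i j by rewrite /a valK.
  have pal_a i j : j < n -> a i (n - j.+1) = a i j.
    move=> lt_jn; rewrite -[j]/(val (Ordinal lt_jn)) aE.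
    by rewrite (eqP (forallP (palA i) _)) -aE.
  have row_a i : tnth R i = (\sum_(j < n./2) a i j).*2 + odd n * a i n./2.
    by rewrite -(sum_palindrome (pal_a i)) -rowAE; apply: eq_bigr => j _; rewrite aE.
  have a_le1 i k : a i k <= 1 by rewrite /a; case: insub => [j|]; rewrite ?leq_b1.
  (* The middle entry is at most 1, so halving the row sum discards exactly that entry. *)
  have half_row i : (tnth R i)./2.*2 = (\sum_(j < n./2) a i j).*2.
    by have := odd_double_half (tnth R i); rewrite (row_a i); have := a_le1 i n./2; lia.
  have row_off i : \sum_(j < n | off_middle n j) A i j = (tnth R i)./2.*2.
    have := sum_off_middle n (a i); rewrite (sum_palindrome (pal_a i)) -half_row.
    move/addIn => ->; by apply: eq_bigr => j _; rewrite aE.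
  have palS : palindromic S.
    move=> j; rewrite -!colAE; apply: eq_bigr => i _.
    by rewrite (eqP (forallP (palA i) j)).
  have off_sum : \sum_(j < n | off_middle n j) s j = sumn (round_even R).
    rewrite sumnE roundE; under [RHS]eq_bigr do rewrite -row_off.
    by rewrite exchange_big; apply: eq_bigr => j _; rewrite -SE -colAE.
  split=> //.
    split=> [even_n i|odd_n].
      by rewrite row_a (negPf even_n) addn0 odd_double.
    by rewrite middleE; move: hRS; rewrite totalR totalS off_sum odd_n; lia.
  split=> [l|]; last by rewrite sumn_conjugate sum_drop.
  rewrite drop_middleE sumn_take_conjugate roundE.
  have [K [sKI leK ->]] := sum_take_sort (tnth S) l uniq_I.
  under eq_bigr do rewrite -colAE.
  (* Within [K], row [i] has at most all its off-middle ones, and at most one per column. *)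
  rewrite exchange_big; apply: leq_sum => i _; rewrite leq_min; apply/andP; split.
    rewrite -row_off big_mkcond [leqRHS]big_mkcond; apply: leq_sum => j _.
    by case: ifP => // /sKI; rewrite mem_filter => /andP[->].
  apply: leq_trans leK; rewrite -sum1_card; apply: leq_sum => j _.
  by rewrite leq_b1.
have pal_s k : k < n -> s (n - k.+1) = s k.
  by move=> lt_kn; have := palS (Ordinal lt_kn); rewrite !SE.
have off_s : \sum_(j < n | off_middle n j) s j = (\sum_(k < n./2) s k).*2.
  by have := sum_off_middle n s; rewrite (sum_palindrome pal_s) => /addIn ->.
have sum_half : \sum_(i < m) (tnth R i)./2 = \sum_(k < n./2) s k.
  apply: double_inj; rewrite -off_s -sum_drop sum_eq sumn_conjugate sumnE roundE.
  by rewrite -!muln2 big_distrl /=; apply: eq_bigr => i _; rewrite muln2.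
have middle_odd : odd n -> num_odd R = s n./2.
  move=> odd_n; move: hRS; rewrite totalR totalS -sum_drop sum_eq sumn_conjugate.
  by rewrite odd_n; lia.
have [i|K|B [rowB colB]] := gale_ryser (r := fun i => (tnth R i)./2)
  (c := fun k : 'I_n./2 => s k) _ sum_half.
- exact/half_leq.
(* The domination inequality for [K] is doubled and read on the symmetric set [K'] of [2 * #|K|]
   off-middle columns, where majorization applies. *)
- rewrite -leq_double -(sum_mirror_set K pal_s).
  set K' := [set _ | _].
  have cardK' : #|K'| = #|K|.*2.
    by rewrite -!sum1_card (sum_mirror_set K (F := fun=> 1)).
  have sKI : {subset K' <= I}.
    move=> j; rewrite inE mem_filter mem_enum andbT /off_middle.
    by apply: contraL => /andP[odd_n /eqP ->]; rewrite mirror_middle.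
  rewrite (eq_bigr (tnth S)) => [|j _]; last by rewrite SE.
  apply: leq_trans (sum_le_take_sort (tnth S) uniq_I sKI) _.
  rewrite -drop_middleE (leq_trans (dom _)) // sumn_take_conjugate roundE.
  rewrite cardK' -!muln2 big_distrl /=; apply: leq_sum => i _.
  by rewrite -muln2 minnMl leqnn.
pose A : 'M[bool]_(m, n) :=
  (\matrix_(i, j) mirror (B i) (odd (tnth R i)) j)%R.
apply/eqP/set0Pn; exists A; rewrite inE; apply/and3P; split; apply/forallP.
- move=> i; apply/eqP; under eq_bigr do rewrite mxE.
  rewrite (sum_palindrome (F := fun j => mirror (B i) _ j)) => [|j lt_jn]; last first.
    by rewrite mirror_rev.
  under eq_bigr do rewrite mirror_ord.
  rewrite rowB -[RHS]odd_double_half addnC; congr (_ + _).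
  case: (boolP (odd n)) => [odd_n|even_n]; first by rewrite mirror_middle ?mul1n.
  by rewrite (negPf (even_case even_n i)).
- move=> j; apply/eqP; under eq_bigr do rewrite mxE.
  rewrite SE /mirror; case: insubP => [k _ k_eq|].
    rewrite colB k_eq; case: (leqP j (n - j.+1)) => _ //.
    exact: pal_s.
  (* Both [j] and its mirror image are at least [n./2], which forces [n] to be odd and [j] to be the
     middle. *)
  move=> ge_h; have lt_jn := ltn_ord j.
  have odd_n : odd n by lia.
  by rewrite (_ : j = n./2 :> nat) -?middle_odd ?num_oddE //; lia.
- by move=> i; apply/forallP => j; rewrite !mxE mirror_rev.
Qed.
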